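(* Let $K$ be a Polish space and let $f:K\to\mathbb{R}$ be a function. Suppose that $K=\bigcup_{j=1}^\infty A^j$, where each $A^j$ is an ambiguous subset of $K$ and $f|_{A^j}\in \mathrm{DSC}(A^j)$ for all $j\ge 1$. Then $f\in \mathrm{DSC}(K)$.
   Context: A subset of $K$ is ambiguous if it is both an $F_\sigma$ and a $G_\delta$ subset of $K$. For a separable metrizable space $X$ (in particular for $X=K$, or a subset of $K$ with the relative topology), $C(X)$ is the class of continuous functions $X\to\mathbb{R}$, and $\mathrm{DSC}(X)$ is the set of $f:X\to\mathbb{R}$ for which there is a sequence $(f_n)\subset C(X)$ with $f_n\to f$ pointwise on $X$ and $\sum_{n=1}^\infty|f_{n+1}(x)-f_n(x)|<\infty$ for every $x\in X$. *)

(* Defs.v *)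
From HB Require Import structures.
From mathcomp Require Import all_boot all_order all_algebra.
From mathcomp Require Import all_classical all_reals all_analysis.
From mathcomp Require Import borel_hierarchy.

Set Implicit Arguments.
Unset Strict Implicit.
Unset Printing Implicit Defensive.

Import Order.TTheory GRing.Theory Num.Theory.
Import numFieldNormedType.Exports.

Local Open Scope classical_set_scope.
Local Open Scope ring_scope.

Definition separable (X : topologicalType) : Prop :=
  exists2 D : set X, countable D & dense D.

(* The library's [completeType] is pointed, hence would exclude the empty
   space; completeness is therefore stated as a property of [metricType]s. *)
Definition complete_metric (R : realType) (M : metricType R) : Prop :=
  forall F : set_system M, ProperFilter F -> cauchy F ->
    exists l : M, F --> l.

Definition homeomorphic (X Y : topologicalType) : Prop :=
  exists (h : X -> Y) (k : Y -> X),
    [/\ cancel h k, cancel k h, continuous h & continuous k].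

Definition completely_metrizable (R : realType) (X : topologicalType) : Prop :=
  exists2 M : metricType R, complete_metric M & homeomorphic X M.

Definition polish (R : realType) (X : topologicalType) : Prop :=
  separable X /\ completely_metrizable R X.

Definition ambiguous (X : topologicalType) (A : set X) : Prop :=
  Fsigma A /\ Gdelta A.

Definition DSC (R : realType) (X : topologicalType) (f : X -> R) : Prop :=
  exists f_ : nat -> X -> R,
    [/\ forall n, continuous (f_ n),
        forall x, f_ n x @[n --> \oo] --> f x &
        forall x, cvgn (series (fun n => `|f_ n.+1 x - f_ n x|))].

(* Main.v *)
Require Import Defs.
From HB Require Import structures.
From mathcomp Require Import all_boot all_order all_algebra.
From mathcomp Require Import all_classical all_reals all_analysis.
From mathcomp Require Import borel_hierarchy.

Import Order.TTheory GRing.Theory Num.Theory.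
Import numFieldNormedType.Exports.

Local Open Scope classical_set_scope.
Local Open Scope ring_scope.

(** The sets [B j := A j `\` \bigcup_(i < j) A i] form a partition of [K]. Each
    is F_sigma, because the complement of a G_delta set is F_sigma
    ([Fsigma_seqDU]), and [f] is still DSC on it; so it is enough to glue along
    a partition into countably many F_sigma sets ([normal_DSC_trivIset]). The
    space [K] is normal, being metrizable ([homeomorphic_normal]).

    Write [B j] as the union of a nondecreasing sequence of closed sets [F j n],
    and let the continuous functions [h j n] on [B j] witness that the
    restriction of [f] is DSC. For fixed [n], the closed sets [F j n], [j < n],
    are pairwise disjoint, so that the function equal to [h j n] on each of them
    is continuous on their union [D n]; truncated to [[-(n+1), n+1]], it extends
    by Tietze's theorem to a continuous [g n] on [K]. A point [x] of [B j] lies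
    in [F j n], hence in [D n], for all large [n], and the truncation is
    eventually inactive at [x] since the sequence [h j n x] is bounded. Hence
    [g n x = h j n x] for all large [n], and both the convergence to [f x] and
    the absolute summability of the increments are inherited from [h j]. *)

Lemma homeomorphic_normal (R : realType) (X Y : topologicalType) :
  homeomorphic X Y -> normal_space Y -> normal_space X.
Proof.
move=> [h [k [hk kh ch ck]]] /(@normal_openP R) nY.
apply/(@normal_openP R) => A B cA cB AB0.
have [| | |U [V [oU oV AU BV UV0]]] := nY (k @^-1` A) (k @^-1` B).
- exact: closed_comp.
- exact: closed_comp.
- by rewrite -preimage_setI AB0 preimage_set0.
exists (h @^-1` U), (h @^-1` V); split.
- by apply: open_comp => // *; exact: ch.
- by apply: open_comp => // *; exact: ch.
- by move=> x Ax; apply: AU; rewrite /= hk.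
- by move=> x Bx; apply: BV; rewrite /= hk.
- by rewrite -preimage_setI UV0 preimage_set0.
Qed.

Lemma Fsigma_nondecreasing (T : topologicalType) (S : set T) : Fsigma S ->
  exists F : nat -> set T, [/\ forall n, closed (F n),
    forall m n, (m <= n)%N -> F m `<=` F n & S = \bigcup_n F n].
Proof.
move=> [F cF ->]; exists (fun n => \big[setU/set0]_(i < n.+1) F i); split.
- by move=> n; exact: closed_bigsetU.
- by move=> m n mn; exact: subset_bigsetU.
- by rewrite bigcup_bigsetU_bigcup.
Qed.

Lemma Fsigma_setI (T : topologicalType) (S S' : set T) :
  Fsigma S -> Fsigma S' -> Fsigma (S `&` S').
Proof.
move=> /Fsigma_nondecreasing[F [cF ndF ->]].
move=> /Fsigma_nondecreasing[G [cG ndG ->]].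
exists (fun n => F n `&` G n); first by move=> n; exact: closedI.
apply/seteqP; split=> [x [[m _ Fx] [n _ Gx]]|x [n _ [Fx Gx]]].
  exists (maxn m n) => //; split; [apply: ndF Fx|apply: ndG Gx].
    exact: leq_maxl.
  exact: leq_maxr.
by split; exists n.
Qed.

Lemma Fsigma_setD (T : topologicalType) (S S' : set T) :
  Fsigma S -> Gdelta S' -> Fsigma (S `\` S').
Proof.
move=> FS [G oG ->]; rewrite setDE; apply: Fsigma_setI => //.
by exists (fun n => ~` G n); [move=> n; exact: open_closedC|rewrite setC_bigcap].
Qed.

Lemma Fsigma_seqDU (T : topologicalType) (A : nat -> set T) :
  (forall j, ambiguous (A j)) -> forall j, Fsigma (seqDU A j).
Proof.
move=> amb j.
suff FD n : Fsigma (A j `\` \big[setU/set0]_(k < n) A k) by exact: FD.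
elim: n => [|i IH]; first by rewrite big_ord0 setD0; case: (amb j).
rewrite big_ord_recr setDUr; apply: Fsigma_setI => //.
by apply: Fsigma_setD; [case: (amb j)|case: (amb i)].
Qed.

(** A DSC witness on a subspace, expressed by functions on the whole space, which
    spares the passage between the subtypes of different subsets. *)
Lemma DSC_sigLP (R : realType) (T : topologicalType) (S : set T) (f : T -> R) :
  @DSC R (set_type S) (sigL S f) <->
  exists g : nat -> T -> R,
    [/\ forall n, {within S, continuous (g n)},
        forall x, S x -> g n x @[n --> \oo] --> f x &
        forall x, S x -> cvgn (series (fun n => `|g n.+1 x - g n x|))].
Proof.
split=> [[u [cu uf su]]|[g [cg gf sg]]].
  have valLE n x (Sx : S x) : valL_ 0 (u n) x = u n (SigSub (mem_set Sx)).
    by rewrite -[in RHS](valLK 0 (u n)).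
  exists (fun n => valL_ 0 (u n)); split=> [n|x Sx|x Sx].
  - exact/subspace_valL_continuousP'.
  - by under eq_fun do rewrite (valLE _ _ Sx); exact: (uf (SigSub (mem_set Sx))).
  - under [fun n => `|_|]eq_fun do rewrite !(valLE _ _ Sx).
    exact: (su (SigSub (mem_set Sx))).
exists (fun n => sigL S (g n)); split=> [n|x|x].
- exact/subspace_sigL_continuousP.
- exact: (gf _ (set_mem (valP x))).
- exact: (sg _ (set_mem (valP x))).
Qed.

Lemma DSC_subset (R : realType) (T : topologicalType) (S S' : set T)
    (f : T -> R) : S `<=` S' ->
  @DSC R (set_type S') (sigL S' f) -> @DSC R (set_type S) (sigL S f).
Proof.
move=> SS' /DSC_sigLP[g [cg gf sg]]; apply/DSC_sigLP; exists g.
split=> [n|x /SS'|x /SS']; [|exact: gf|exact: sg].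
exact: continuous_subspaceW (cg n).
Qed.

Lemma bigsetU_within_continuous (T U : topologicalType) (C : nat -> set T)
    (f : T -> U) n : (forall j, closed (C j)) ->
  (forall j, {within C j, continuous f}) ->
  {within \big[setU/set0]_(j < n) C j, continuous f}.
Proof.
move=> cC fC; elim: n => [|n IH].
  by rewrite big_ord0; exact: continuous_subspace0.
rewrite big_ord_recr; apply: withinU_continuous => //.
by apply: closed_bigsetU.
Qed.

(** The truncation of [y] to the interval [[-M, M]], for [0 <= M]. *)
Definition clamp {R : realType} (M y : R) : R := Num.max (- M) (Num.min M y).

Lemma clamp_le (R : realType) (M y : R) : 0 <= M -> `|clamp M y| <= M.
Proof.
move=> M0; rewrite /clamp ler_norml le_max lexx ge_max ge_min lexx /= andbT.
by rewrite (le_trans _ M0)// oppr_le0.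
Qed.

Lemma clamp_id (R : realType) (M y : R) : `|y| <= M -> clamp M y = y.
Proof. by rewrite ler_norml => /andP[? ?]; rewrite /clamp min_r// max_r. Qed.

Lemma continuous_clamp (R : realType) (T : topologicalType) (M : R)
    (f : T -> R) : continuous f -> continuous (fun x => clamp M (f x)).
Proof.
move=> cf x.
apply: (@continuous_max R T (fun=> - M) (fun x => Num.min M (f x))).
  exact: cvg_cst.
apply: (@continuous_min R T (fun=> M) f); first exact: cvg_cst.
exact: cf.
Qed.

Lemma is_cvg_series_eventually (R : realType) (u v : nat -> R) :
  (\forall n \near \oo, u n = v n) -> cvgn (series v) -> cvgn (series u).
Proof.
move=> [N _ uv]; rewrite -(is_cvg_series_restrict N v).
rewrite -(is_cvg_series_restrict N u).
suff -> : (fun n => \sum_(N <= k < n) u k) = (fun n => \sum_(N <= k < n) v k).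
  by [].
by apply/funext => n; apply: eq_big_nat => k /andP[Nk _]; exact: uv.
Qed.

(** The gluing argument: in a normal space, a function that is DSC on each member
    of a countable partition into F_sigma sets is DSC. *)
Lemma normal_DSC_trivIset (R : realType) (T : topologicalType) (f : T -> R)
    (B : nat -> set T) : normal_space T ->
  trivIset setT B -> \bigcup_j B j = setT -> (forall j, Fsigma (B j)) ->
  (forall j, @DSC R (set_type (B j)) (sigL (B j) f)) -> DSC f.
Proof.
move=> nT tB covB FB dB.
have /choice[F FP] := fun j => Fsigma_nondecreasing _ _ (FB j).
have cF j n : closed (F j n) by have [] := FP j.
have ndF j m n : (m <= n)%N -> F j m `<=` F j n by have [_ + _] := FP j; apply.
have FE j : B j = \bigcup_n F j n by have [] := FP j.
have FsubB j n : F j n `<=` B j by move=> x Fx; rewrite FE; exists n.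
have /choice[h hP] := fun j => (DSC_sigLP _ _ _ _).1 (dB j).
have /choice[idx idxP] : forall x, exists j, B j x.
  by move=> x; have : setT x by []; rewrite -covB => -[j _ Bx]; exists j.
have idxE j x : B j x -> idx x = j.
  by move=> Bx; apply: (tB (idx x) j I I); exists x; split => //; exact: idxP.
(* The truncation makes the bounded form of Tietze's theorem applicable; the
   bound is [n.+1] rather than [n] because it has to be positive. *)
pose p n x := clamp n.+1%:R (h (idx x) n x).
pose D n := \big[setU/set0]_(j < n) F j n.
have clD n : closed (D n) by apply: closed_bigsetU.
have cp n : {within D n, continuous (p n)}.
  apply: (bigsetU_within_continuous _ _ (fun j => F j n)) => // j.
  (* On [F j n], which lies in [B j], the index [idx x] is constantly [j]. *)
  have -> : {within F j n, continuous (p n)} <->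
      {within F j n, continuous (fun x => clamp n.+1%:R (h j n x))}.
    by split; apply: subspace_eq_continuous => x /set_mem/FsubB/idxE;
      rewrite /p /from_subspace => ->.
  apply: continuous_clamp; apply: continuous_subspaceW (FsubB j n) _.
  by have [+ _ _] := hP j; apply.
have /choice[g gP] : forall n, exists g : T -> R,
    {in D n, p n =1 g} /\ continuous g.
  move=> n; have [||g [pg cg _]] :=
    @continuous_bounded_extension T R nT (D n) (clD n) (p n) n.+1%:R _ (cp n).
  - by rewrite ltr0n.
  - by move=> x _; exact: clamp_le.
  - by exists g.
have gh x : \forall n \near \oo, g n x = h (idx x) n x.
  have [N FNx] : exists N, F (idx x) N x.
    by have := idxP x; rewrite FE => -[N _ ?]; exists N.
  have [_ /(_ _ (idxP x)) hf _] := hP (idx x).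
  have [M hM] : exists M : R, \forall n \near \oo, `|h (idx x) n x| <= M.
    exact/ex_bound/cvg_bounded/hf.
  near=> n.
  have xD : x \in D n.
    apply/mem_set; rewrite /D -(bigcup_mkord n (fun j => F j n)).
    exists (idx x) => /=.
      by near: n; exact: nbhs_infty_gt.
    by apply: ndF FNx; near: n; exact: nbhs_infty_ge.
  have [/(_ x xD) <- _] := gP n.
  rewrite /p clamp_id//; apply: (@le_trans _ _ M); first by near: n.
  rewrite (@le_trans _ _ n%:R) ?ler_nat//; near: n; exact: nbhs_infty_ger.
exists g; split=> [n|x|x].
- by have [] := gP n.
- have [_ /(_ _ (idxP x)) hf _] := hP (idx x).
  by apply: cvg_trans hf; apply: near_eq_cvg; near=> n; apply/esym; near: n.
- have [_ _ /(_ _ (idxP x))] := hP (idx x); apply: is_cvg_series_eventually.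
  have [N _ ghN] := gh x; exists N => // n Nn.
  by rewrite !ghN//=; exact: leqW.
Unshelve. all: by end_near. Qed.

Theorem theorem4p4 (R : realType) (K : topologicalType) (f : K -> R)
    (A : nat -> set K) :
  polish R K ->
  \bigcup_j A j = [set: K] ->
  (forall j, ambiguous (A j)) ->
  (forall j, @DSC R (set_type (A j)) (sigL (A j) f)) ->
  DSC f.
Proof.
move=> [_ [M _ KM]] covA ambA dA.
apply: (normal_DSC_trivIset R K f (seqDU A)).
- exact: (homeomorphic_normal R K M KM) pseudometric_normal.
- exact: trivIset_seqDU.
- by rewrite -seqDU_bigcup_eq.
- exact: Fsigma_seqDU.
- by move=> j; apply: DSC_subset (dA j); exact: subset_seqDU.
Qed.
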